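(* For integers $m \ge 4$, $l \ge 5$ let $$g(m,l) = \binom{m+l-4}{m-2} - \binom{m+l-6}{l-3} + \binom{m+l-8}{l-5}.$$ Then every $(m,l)$-free set $S$ of more than $g(m,l)$ points contains an $(m,l)$-good point $s$, and this point $s$ is moreover the left endpoint of an $(l-1)$-cap.
   Context: All point sets are finite sets in the plane in general position (no three collinear), with pairwise distinct $x$-coordinates. A set of $n$ points, listed as $(x_1,y_1),\dots,(x_n,y_n)$ with $x_1<\dots<x_n$, is an $n$-cup if $\frac{y_2-y_1}{x_2-x_1} < \dots < \frac{y_n-y_{n-1}}{x_n-x_{n-1}}$, and an $n$-cap if $\frac{y_2-y_1}{x_2-x_1} > \dots > \frac{y_n-y_{n-1}}{x_n-x_{n-1}}$. Its left (right) endpoint is the point with smallest (largest) $x$-coordinate. A set is $(n,m)$-free if it contains no $n$-cup and no $m$-cap. The term $\binom{m+l-4}{m-2}$ is the paper's $f(m,l)$, the maximum size of an $(m,l)$-free set. Given a set $S$ and $s\in S$, $s$ is called $(m,l)$-good if for every $n\ge 4$ the following holds: whenever a set $B$ with $|B|\le n-2$ is adjoined to $S$ such that $S\cup B$ contains an $(n-1)$-cup whose left endpoint is $s$ and whose right endpoint lies in $B$, then $S\cup B$ contains an $l$-cap whose two rightmost points belong to $S$, or an $m$-cup whose two leftmost points belong to $S$, or $n$ points forming a convex $n$-gon. *)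

(* Defs.v *)
From HB Require Import structures.
From mathcomp Require Import all_boot all_order all_algebra finmap reals.

Set Implicit Arguments.
Unset Strict Implicit.
Unset Printing Implicit Defensive.

Import Order.TTheory GRing.Theory Num.Theory.

Local Open Scope fset_scope.
Local Open Scope ring_scope.

(* Every [-] below is truncated, but harmlessly so for m >= 4 and l >= 5: each
   argument of a binomial is then nonnegative, and
   'C(m + l - 6, l - 3) <= 'C(m + l - 4, l - 2) = 'C(m + l - 4, m - 2). *)
Definition g (m l : nat) : nat :=
  ('C(m + l - 4, m - 2) - 'C(m + l - 6, l - 3) + 'C(m + l - 8, l - 5))%N.

Section PlanarPointSets.
Variable R : realType.
Implicit Types (p q r s : R * R) (A B S : {fset R * R}) (c : seq (R * R)).

Definition collinear p q r : bool :=
  (q.1 - p.1) * (r.2 - p.2) == (q.2 - p.2) * (r.1 - p.1).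

Definition general_position A : Prop :=
  {in A &, forall p q, p.1 = q.1 -> p = q} /\
  {in A & &, forall p q r,
    p != q -> q != r -> p != r -> ~~ collinear p q r}.

Definition slope p q : R := (q.2 - p.2) / (q.1 - p.1).

Definition slopes c : seq R := if c is p :: c' then pairmap slope p c' else [::].

Definition left_to_right c : bool := sorted (fun p q => p.1 < q.1) c.

(* An n-cup (n-cap) is represented by the list of its points in the order of
   increasing x-coordinates, which the underlying set determines.  Its left
   (right) endpoint is thus the first (last) element of the list. *)
Definition is_cup (n : nat) c : bool :=
  [&& size c == n, left_to_right c & sorted <%R (slopes c)].

Definition is_cap (n : nat) c : bool :=
  [&& size c == n, left_to_right c & sorted >%R (slopes c)].

Definition cup_cap_free (n m : nat) A : Prop :=
  (forall c, {subset c <= A} -> ~~ is_cup n c) /\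
  (forall c, {subset c <= A} -> ~~ is_cap m c).

Definition in_convex_hull A p : Prop :=
  exists w : R * R -> R,
    [/\ forall q, q \in A -> 0 <= w q,
        \sum_(q <- A) w q = 1
      & p = (\sum_(q <- A) w q * q.1, \sum_(q <- A) w q * q.2)].

Definition is_convex_gon (n : nat) A : Prop :=
  #|` A| = n /\ forall p, p \in A -> ~ in_convex_hull (A `\ p) p.

(* Adjoining [B] to [S] means adding new points, hence the disjointness; the
   resulting set is again in general position. *)
Definition good (m l : nat) S s : Prop :=
  forall (n : nat) B, (4 <= n)%N ->
    [disjoint S & B] -> general_position (S `|` B) -> (#|` B| <= n - 2)%N ->
    (exists c, [/\ {subset s :: c <= S `|` B}, is_cup (n - 1)%N (s :: c)
                 & last s c \in B]) ->
  [\/ exists c, [/\ {subset c <= S `|` B}, is_cap l c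
                  & {subset drop (l - 2)%N c <= S}],
      exists c, [/\ {subset c <= S `|` B}, is_cup m c
                  & {subset take 2 c <= S}]
    | exists A, A `<=` S `|` B /\ is_convex_gon n A].

End PlanarPointSets.

(* Main.v *)
Require Import Defs.
From HB Require Import structures.
From mathcomp Require Import all_boot all_order all_algebra finmap reals.
From mathcomp Require Import boolp ring lra zify.

Set Implicit Arguments.
Unset Strict Implicit.
Unset Printing Implicit Defensive.

Import Order.TTheory GRing.Theory Num.Theory.

Local Open Scope fset_scope.
Local Open Scope ring_scope.

(* A point s of S which is both the right endpoint of an (m-2)-cup ..., e0, s of
   S and the left endpoint of an (l-1)-cap s, d2, d3, ... of S is good: here
   e0, s, d2 is a cup, as e0, s, d2, d3, ... is not an l-cap.  Let
   s, ..., v, u, b be an (n-1)-cup with b in B.  If d2 is left of b, either d2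
   lies below the line sb and ..., e0, s, d2, b is an m-cup, or d2 completes the
   (n-1)-cup to a convex n-gon.  If d2 is right of b, then unless there is an
   n-cup (through u, b, d2), an l-cap (u, b, d2, d3, ...), an m-cup
   (..., e0, s, u, b) or an l-cap (v, u, d2, d3, ...), the points s, ..., v, u, d2
   form an (n-1)-cup above whose chord s d2 lies b, hence again an n-gon.

   Such an s exists by counting.  Let A be the set of left endpoints of
   (l-1)-caps of S.  The set S \ A is (m, l-1)-free, and if no (m-2)-cup lies in
   A then A is (m-2, l)-free; by the Erdős–Szekeres cups-caps theorem S then has
   at most f(m, l-1) + f(m-2, l) = f(m, l) - f(m-1, l-1) <= g(m, l) points. *)

(** * Orientation of point triples and its sign rules for four points *)

Section Orientation.
Variable R : realType.
Implicit Types a b c d : R * R.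

(** Twice the signed area of the triangle. For points listed from left to right, a positive value
    means a 3-cup ([b] below the line [ac]), a negative one a 3-cap. *)
Definition orient a b c : R :=
  (b.1 - a.1) * (c.2 - a.2) - (b.2 - a.2) * (c.1 - a.1).

Lemma orient_rot a b c : orient b c a = orient a b c.
Proof. by rewrite /orient; ring. Qed.

Lemma orient_swap a b c : orient a c b = - orient a b c.
Proof. by rewrite /orient; ring. Qed.

Lemma orient_abb a b : orient a b b = 0.
Proof. by rewrite /orient; ring. Qed.

Lemma orient_aba a b : orient a b a = 0.
Proof. by rewrite /orient; ring. Qed.

Lemma slope_sub a b c : a.1 < b.1 -> b.1 < c.1 ->
  slope b c - slope a b = orient a b c / ((b.1 - a.1) * (c.1 - b.1)).
Proof.
move=> ab bc; rewrite /slope /orient; field.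
by rewrite !subr_eq0 !gt_eqF.
Qed.

Lemma slope_ltE a b c : a.1 < b.1 -> b.1 < c.1 ->
  (slope a b < slope b c) = (0 < orient a b c).
Proof.
move=> ab bc; rewrite -subr_gt0 slope_sub // pmulr_lgt0 //.
by rewrite invr_gt0 mulr_gt0 ?subr_gt0.
Qed.

Lemma slope_gtE a b c : a.1 < b.1 -> b.1 < c.1 ->
  (slope b c < slope a b) = (orient a b c < 0).
Proof.
move=> ab bc; rewrite -subr_lt0 slope_sub // pmulr_llt0 //.
by rewrite invr_gt0 mulr_gt0 ?subr_gt0.
Qed.

(* The linear dependency between four points, applied to the affine function
   [x - x_b], respectively [x - x_c]. *)
Lemma orient_pivot2 a b c d : (b.1 - a.1) * orient b c d =
  (c.1 - b.1) * orient a b d - (d.1 - b.1) * orient a b c.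
Proof. by rewrite /orient; ring. Qed.

Lemma orient_pivot3 a b c d : (d.1 - c.1) * orient a b c =
  (c.1 - b.1) * orient a c d - (c.1 - a.1) * orient b c d.
Proof. by rewrite /orient; ring. Qed.

(** [orient a b] is affine: its value at [r] is its interpolation along the chord [pq], corrected by
    the vertical offset of [r] from that chord. *)
Lemma orient_affine a b p q r : (q.1 - p.1) * orient a b r =
  (q.1 - r.1) * orient a b p + (r.1 - p.1) * orient a b q
  - (b.1 - a.1) * orient p r q.
Proof. by rewrite /orient; ring. Qed.

Section FourPoints.
Variables a b c d : R * R.
Hypotheses (ab : a.1 < b.1) (bc : b.1 < c.1) (cd : c.1 < d.1).

Let ba_gt0 : 0 < b.1 - a.1. Proof. by rewrite subr_gt0. Qed.
Let cb_gt0 : 0 < c.1 - b.1. Proof. by rewrite subr_gt0. Qed.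
Let dc_gt0 : 0 < d.1 - c.1. Proof. by rewrite subr_gt0. Qed.
Let ca_gt0 : 0 < c.1 - a.1.
Proof. by rewrite subr_gt0 (lt_trans ab). Qed.
Let db_gt0 : 0 < d.1 - b.1.
Proof. by rewrite subr_gt0 (lt_trans bc). Qed.

(** This and the next four sign rules follow from a pivot identity whose coefficients are all
    positive horizontal gaps. *)
Lemma cup_abd : 0 < orient a b c -> 0 < orient b c d -> 0 < orient a b d.
Proof.
move=> abc bcd; rewrite -(pmulr_rgt0 _ cb_gt0).
have := orient_pivot2 a b c d; have := mulr_gt0 ba_gt0 bcd.
have := mulr_gt0 db_gt0 abc; lra.
Qed.

Lemma cup_acd : 0 < orient a b c -> 0 < orient b c d -> 0 < orient a c d.
Proof.
move=> abc bcd; rewrite -(pmulr_rgt0 _ cb_gt0).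
have := orient_pivot3 a b c d; have := mulr_gt0 ca_gt0 bcd.
have := mulr_gt0 dc_gt0 abc; lra.
Qed.

Lemma cup_bcd : orient a b c < 0 -> 0 < orient a b d -> 0 < orient b c d.
Proof.
move=> abc abd; rewrite -(pmulr_rgt0 _ ba_gt0) orient_pivot2.
by rewrite subr_gt0 (@lt_trans _ _ 0) ?pmulr_rlt0 ?mulr_gt0.
Qed.

Lemma cap_bcd : 0 < orient a b c -> orient a c d < 0 -> orient b c d < 0.
Proof.
move=> abc acd; rewrite -(pmulr_rlt0 _ ca_gt0).
have := orient_pivot3 a b c d; have := mulr_gt0 dc_gt0 abc.
have : (c.1 - b.1) * orient a c d < 0 by rewrite pmulr_rlt0.
lra.
Qed.

Lemma cap_abc : orient a c d < 0 -> 0 < orient b c d -> orient a b c < 0.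
Proof.
move=> acd bcd; rewrite -(pmulr_rlt0 _ dc_gt0) orient_pivot3.
by rewrite subr_lt0 (@lt_trans _ _ 0) ?pmulr_rlt0 ?mulr_gt0.
Qed.

End FourPoints.

Lemma orient_neq0 (A : {fset R * R}) a b c : general_position A ->
  a \in A -> b \in A -> c \in A -> a.1 < b.1 -> b.1 < c.1 ->
  orient a b c != 0.
Proof.
move=> [_ gen] aA bA cA ab bc.
have neq x y : x.1 < y.1 -> x != y :> R * R.
  by move=> xy; apply: contraTneq xy => ->; rewrite ltxx.
by rewrite subr_eq0 gen ?neq // (lt_trans ab).
Qed.

Lemma orientP (A : {fset R * R}) a b c : general_position A ->
  a \in A -> b \in A -> c \in A -> a.1 < b.1 -> b.1 < c.1 ->
  0 < orient a b c \/ orient a b c < 0.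
Proof.
move=> gen aA bA cA ab bc.
have := orient_neq0 gen aA bA cA ab bc.
by case: ltgtP; auto.
Qed.

End Orientation.

(** * Gluing and extending cups and caps, treated uniformly *)

Section Chains.
Variables (R : realType) (r : rel R).
Implicit Types (p q s : R * R) (c t : seq (R * R)).

Definition chain c : bool := left_to_right c && sorted r (slopes c).

(** The two chains share the edge [pq], so every three consecutive points of the union already lie
    in one of them. *)
Lemma chain_glue c p q t :
  chain (c ++ [:: p; q]) -> chain [:: p, q & t] -> chain (c ++ [:: p, q & t]).
Proof.
elim: c => [|a c IH] // H1 H2.
have := IH; move: H1; case: c {IH} => [|b [|b' c]] /=.
- rewrite /chain /= !andbT => /andP[/andP[ab _] rab] _.
  by move: H2; rewrite /chain /= ab rab.
- rewrite /chain /= !andbT => /andP[/andP[-> ->] /andP[-> ->]] /= IH.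
  exact: IH.
rewrite /chain /= => /andP[/andP[-> H3] /andP[-> H4]] /= IH.
by apply: IH => //; apply/andP.
Qed.

Lemma chain_catl c t : chain (c ++ t) -> chain c.
Proof.
rewrite /chain /left_to_right => /andP[/cat_sorted2[-> _]] /=.
case: c => [|p c] //=; rewrite pairmap_cat.
by case/cat_sorted2.
Qed.

Lemma chain_catr c t : chain (c ++ t) -> chain t.
Proof.
rewrite /chain /left_to_right => /andP[/cat_sorted2[_ ->]] /=.
elim: c => [|p c IH] //= H; apply: IH.
by case: (c ++ t) H => //= a u /path_sorted.
Qed.

Lemma chain2 p q : chain [:: p; q] = (p.1 < q.1).
Proof. by rewrite /chain /= !andbT. Qed.

Lemma chain3 p q s :
  chain [:: p; q; s] = [&& p.1 < q.1, q.1 < s.1 & r (slope p q) (slope q s)].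
Proof. by rewrite /chain /= !andbT andbA. Qed.

Lemma chain_cons p q s t : p.1 < q.1 -> r (slope p q) (slope q s) ->
  chain [:: q, s & t] -> chain [:: p, q, s & t].
Proof.
move=> pq pqs H; apply: (@chain_glue [:: p]) => //=.
rewrite chain3 pq pqs andbT.
by move: H; rewrite /chain /= => /andP[/andP[]].
Qed.

Lemma chain_rcons c p q s : q.1 < s.1 -> r (slope p q) (slope q s) ->
  chain (c ++ [:: p; q]) -> chain (c ++ [:: p; q; s]).
Proof.
move=> qs pqs H; apply: chain_glue => //.
rewrite chain3 qs pqs !andbT.
by have /chain_catr := H; rewrite chain2.
Qed.

End Chains.

Lemma is_cupE (R : realType) n (c : seq (R * R)) :
  is_cup n c = (size c == n) && chain <%R c.
Proof. by []. Qed.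

Lemma is_capE (R : realType) n (c : seq (R * R)) :
  is_cap n c = (size c == n) && chain >%R c.
Proof. by []. Qed.

(** * Convex polygons obtained from cups *)

Section Cups.
Variables (R : realType) (p0 : R * R).
Implicit Types (p q a b x : R * R) (c : seq (R * R)) (A : {fset R * R}).

Let lt1_trans : transitive (fun p q : R * R => p.1 < q.1).
Proof. by move=> p q s; apply: lt_trans. Qed.

Lemma left_to_right_nth c i j : left_to_right c ->
  (i < j)%N -> (j < size c)%N -> (nth p0 c i).1 < (nth p0 c j).1.
Proof.
move=> cs ij jc.
by apply: (sorted_ltn_nth lt1_trans p0 cs) => //; rewrite inE // (ltn_trans ij).
Qed.

Lemma left_to_right_uniq c : left_to_right c -> uniq c.
Proof. by apply: sorted_uniq => // p; rewrite /= ltxx. Qed.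

Lemma cup_orient_succ c i : chain <%R c -> (i.+2 < size c)%N ->
  0 < orient (nth p0 c i) (nth p0 c i.+1) (nth p0 c i.+2).
Proof.
move=> /andP[cx cs] ic; rewrite -slope_ltE ?left_to_right_nth //; last first.
  exact: ltnW.
case: c cs {cx} ic => //= p c /(sortedP 0)/(_ i); rewrite size_pairmap => H ic.
by have := H ic; rewrite !(nth_pairmap p0) // ltnW.
Qed.

(** [edge] keeps the first two indices adjacent and pushes the third one away with [cup_abd]; an
    induction on the gap [j - i] then uses [cup_acd]. *)
Lemma cup_orient c i j k : chain <%R c ->
  (i < j)%N -> (j < k)%N -> (k < size c)%N ->
  0 < orient (nth p0 c i) (nth p0 c j) (nth p0 c k).
Proof.
move=> cup ij jk kc; have cx : left_to_right c by case/andP: cup.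
have lt_nth i1 i2 : (i1 < i2)%N -> (i2 <= k)%N -> (nth p0 c i1).1 < (nth p0 c i2).1.
  by move=> i12 i2k; apply: left_to_right_nth => //; lia.
have edge d i1 : (i1 + d.+2 <= k)%N ->
    0 < orient (nth p0 c i1) (nth p0 c i1.+1) (nth p0 c (i1 + d.+2)).
  elim: d i1 => [|d IH] i1 i1k.
    by rewrite addn2; apply: cup_orient_succ => //; lia.
  apply: (@cup_abd _ _ _ (nth p0 c i1.+2)); rewrite ?lt_nth //; try lia.
    by apply: cup_orient_succ => //; lia.
  by rewrite -addSnnS IH //; lia.
have [d E] : exists d, (i + d.+1)%N = j by exists (j - i.+1)%N; lia.
elim: d i ij E => [|d IH] i ij E.
  have -> : j = i.+1 by lia.
  have -> : k = (i + (k - i.+2).+2)%N by lia.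
  by apply: edge; lia.
apply: (@cup_acd _ _ (nth p0 c i.+1)); rewrite ?lt_nth //; try lia.
  by rewrite -E edge //; lia.
by apply: IH; lia.
Qed.

(* [nthP] restated so that [size c] is at the type [seq (R * R)], not at an
   equality type: [lia] does not identify the two. *)
Lemma mem_nthP c x : x \in c -> exists2 i, (i < size c)%N & nth p0 c i = x.
Proof. by move=> /(nthP p0). Qed.

(** A weighted mean of a linear functional cannot lie strictly below all its values: the weighted
    excesses are nonnegative with sum 0, so all weights would vanish. *)
Lemma not_in_hull A p (u v : R) :
  (forall x, x \in A -> u * p.1 + v * p.2 < u * x.1 + v * x.2) ->
  ~ in_convex_hull A p.
Proof.
move=> sep [w [w0 w1 pE]].
have /eqP : \sum_(q <- A) w q * ((u * q.1 + v * q.2) - (u * p.1 + v * p.2)) = 0.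
  have -> : p.1 = \sum_(q <- A) w q * q.1 by rewrite {1}pE.
  have -> : p.2 = \sum_(q <- A) w q * q.2 by rewrite {1}pE.
  set a := \sum_(q <- A) w q * q.1; set b := \sum_(q <- A) w q * q.2.
  under eq_bigr => q _.
    rewrite (_ : _ * _ = u * (w q * q.1) + v * (w q * q.2)
                         - (u * a + v * b) * w q); last by ring.
    over.
  by rewrite sumrB big_split /= -!mulr_sumr w1 mulr1 subrr.
rewrite big_seq psumr_eq0 => [/allP/= w_eq0|q qA]; last first.
  by rewrite mulr_ge0 ?w0 // subr_ge0 ltW ?sep.
suff : \sum_(q <- A) w q = 0 by rewrite w1 => /eqP; rewrite oner_eq0.
rewrite big_seq big1 // => q qA; have := w_eq0 q qA.
by rewrite qA mulf_eq0 subr_eq0 [_ == _ + _]gt_eqF ?sep // orbF => /eqP.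
Qed.

Lemma not_in_hull_orient A a b p : orient a b p < 0 ->
  (forall x, x \in A -> 0 <= orient a b x) -> ~ in_convex_hull A p.
Proof.
(* The coefficients are those of the linear part of [orient a b]. *)
move=> p_lt0 A_ge0; apply: (@not_in_hull _ _ (a.2 - b.2) (b.1 - a.1)) => x xA.
by have := lt_le_trans p_lt0 (A_ge0 x xA); rewrite /orient; lra.
Qed.

(** The points lie strictly above the chord joining the ends of [c]. A list covers both the bare cup
    and the cup with one extra point. *)
Definition over_cup c (rs : seq (R * R)) := forall r, r \in rs ->
  [/\ (nth p0 c 0).1 < r.1, r.1 < (nth p0 c (size c).-1).1
    & orient (nth p0 c 0) r (nth p0 c (size c).-1) < 0].

(** An endpoint of the cup is separated from the rest by its x-coordinate, an inner vertex by the
    line through its two neighbours. *)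
Lemma cup_vertex c rs p : chain <%R c -> over_cup c rs -> p \in c ->
  ~ in_convex_hull ([fset x in c ++ rs] `\ p) p.
Proof.
move=> cup above pc; have cx : left_to_right c by case/andP: cup.
have [i ic pE] := mem_nthP pc.
have memE x : x \in [fset x in c ++ rs] `\ p ->
    x \in rs \/ exists j, [/\ x = nth p0 c j, (j < size c)%N & j != i].
  rewrite in_fsetD1 in_fset mem_cat => /andP[xp /orP[/mem_nthP[j jc xE]|]]; last by left.
  right; exists j; split=> //; apply: contraNneq xp => ji.
  by rewrite -xE -pE ji.
have [i0|i_gt0] := posnP i.
  apply: (@not_in_hull _ _ 1 0) => x /memE; rewrite !mul0r !addr0 !mul1r -pE i0.
  case=> [/above[]//|[j [-> jc j0]]].
  by apply: left_to_right_nth => //; rewrite lt0n.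
have [i_last|i_lt] := leqP (size c).-1 i.
  have iE : i = (size c).-1 by lia.
  apply: (@not_in_hull _ _ (-1) 0) => x /memE.
  rewrite !mul0r !addr0 !mulN1r ltrN2 -pE iE.
  case=> [/above[]//|[j [-> jc ji]]].
  by apply: left_to_right_nth => //; lia.
set a := nth p0 c i.-1; set b := nth p0 c i.+1.
have ab_ge0 j : (j < size c)%N -> j != i -> 0 <= orient a b (nth p0 c j).
  move=> jc ji; rewrite {}/a {}/b.
  have [jlt|jgt|->] := ltngtP j i.-1; last by rewrite orient_aba.
    rewrite orient_rot ltW // cup_orient //; lia.
  have [jlt'|jgt'|->] := ltngtP j i.+1; last by rewrite orient_abb.
    by move: ji; rewrite (_ : j = i) ?eqxx //; lia.
  rewrite ltW // cup_orient //; lia.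
apply: (@not_in_hull_orient _ a b).
  rewrite orient_swap oppr_lt0 -pE cup_orient //; lia.
move=> x /memE[/above[x1 x2 x3]|[j [-> jc ji]]]; last exact: ab_ge0.
(* Both ends of the chord are on or above the line [ab], and [x] is above the chord; [orient_affine]
   combines the two facts. *)
have pq := lt_trans x1 x2.
rewrite -(pmulr_rge0 _ (_ : 0 < (nth p0 c (size c).-1).1 - (nth p0 c 0).1));
  last by rewrite subr_gt0.
rewrite orient_affine subr_ge0 (@le_trans _ _ 0) //.
  rewrite pmulr_rle0; first exact: ltW.
  by rewrite subr_gt0 left_to_right_nth //; lia.
apply: addr_ge0; apply: mulr_ge0; try by rewrite subr_ge0 ltW.
  by apply: ab_ge0; lia.
by apply: ab_ge0; lia.
Qed.

Lemma cup_gon n c : is_cup n c -> is_convex_gon n [fset x in c].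
Proof.
rewrite is_cupE => /andP[/eqP<- cup]; split.
  by rewrite card_fseq undup_id // left_to_right_uniq //; case/andP: cup.
move=> p; rewrite in_fset => pc; rewrite -[c]cats0.
exact: cup_vertex.
Qed.

Lemma cup_point_gon n c r : is_cup n c -> over_cup c [:: r] ->
  is_convex_gon n.+1 [fset x in c ++ [:: r]].
Proof.
rewrite is_cupE => /andP[/eqP<- cup] above.
have cx : left_to_right c by case/andP: cup.
have [r1 r2 r3] := above r (mem_head _ _).
have c_gt0 : (0 < size c)%N.
  by case: (c) r1 r2 => //= /lt_trans H /H; rewrite ltxx.
have c_le0 x : x \in c ->
    0 <= orient (nth p0 c 0) x (nth p0 c (size c).-1).
  move=> /mem_nthP[j jc <-].
  have [->|j_gt0] := posnP j; first by rewrite -orient_rot orient_aba.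
  have [jlt|jlast] := ltnP j (size c).-1.
    by rewrite ltW // cup_orient //; lia.
  by rewrite (_ : j = (size c).-1) ?orient_abb //; lia.
have rc : r \notin c by apply: contraTN r3 => /c_le0; rewrite leNgt.
split.
  rewrite card_fseq undup_id ?size_cat ?addn1 //.
  by rewrite cats1 rcons_uniq rc left_to_right_uniq.
move=> p; rewrite in_fset mem_cat mem_seq1 => /orP[|/eqP->].
  exact: cup_vertex.
(* The chord itself separates [r] from the cup; it is directed from right to left so that the cup
   gets the nonnegative side. *)
apply: (@not_in_hull_orient _ (nth p0 c (size c).-1) (nth p0 c 0)).
  by rewrite -orient_rot.
move=> x; rewrite in_fsetD1 in_fset mem_cat mem_seq1 => /andP[/negPf->]; rewrite orbF.
by rewrite -orient_rot; apply: c_le0.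
Qed.

End Cups.

(** * Goodness of a point that ends a cup and starts a cap *)

Section Goodness.
Variable R : realType.
Implicit Types (p q s : R * R) (c t : seq (R * R)) (S A : {fset R * R}).

Lemma cup_endpoints s u b c :
  chain <%R (s :: c ++ [:: u; b]) -> 0 < orient s u b.
Proof.
move=> cup.
have /(_ (ltnSn _)) := @cup_orient _ s _ 0 (size c).+1 (size c).+2 cup isT.
rewrite /= size_cat !nth_cat ltnn subnn subSnn addn2.
by rewrite (_ : (_ < size c)%N = false) => [|]; [apply | lia].
Qed.

Lemma fset_of_seq_sub c A : all (mem A) c -> [fset x in c] `<=` A.
Proof. by move=> /allP cA; apply/fsubsetP => x; rewrite in_fset; apply: cA. Qed.

Lemma good_endpoint m l S s e e0 d2 d3 d :
  {subset e ++ [:: e0; s] <= S} -> is_cup (m - 2)%N (e ++ [:: e0; s]) ->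
  {subset [:: s, d2, d3 & d] <= S} -> is_cap (l - 1)%N [:: s, d2, d3 & d] ->
  good m l S s.
Proof.
rewrite is_cupE is_capE.
move=> /allP eS /andP[/eqP size_e cupE] /allP dS /andP[/eqP size_d capD].
move=> n B n4 /fdisjointP disj gen _ [c [/allP cU]].
rewrite is_cupE => /andP[/eqP size_c cupC] bB.
move: size_c; rewrite size_cat /= in size_e size_d * => size_c.
(* As [n] is at least 4, the cup has at least two points [u], [b] after [s]. *)
case/lastP: c => [|c b] in cU size_c cupC bB *; first by move: size_c n4; clear => /=; lia.
case/lastP: c => [|c u] in cU size_c cupC bB *; first by move: size_c n4; clear => /=; lia.
rewrite last_rcons in bB.
rewrite -!cats1 -catA in cU size_c cupC.
have size_n : n = (size c).+4.
  by move: size_c n4; rewrite size_cat /=; clear; lia.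
have size_m : m = (size e).+4 by move: size_e; clear; lia.
have size_l : l = (size d).+4 by move: size_d; clear; lia.
set U := S `|` B in gen cU *.
have SU x : x \in S -> x \in U by rewrite inE => ->.
have SUall t : all (mem S) t -> all (mem U) t by apply: sub_all => x /SU.
move: eS dS cU; rewrite /= !all_cat /= !andbT.
move=> /and3P[eS e0S sS] /and4P[_ d2S d3S dS] /and4P[sU cU uU bU].
have [eU dU] := (SUall _ eS, SUall _ dS).
have [e0U d2U d3U] := And3 (SU _ e0S) (SU _ d2S) (SU _ d3S).
have e0s : e0.1 < s.1 by have /chain_catr := cupE; rewrite chain2.
have [su ub] : s.1 < u.1 /\ u.1 < b.1.
  split; last by have /(@chain_catr _ _ (s :: c)) := cupC; rewrite chain2.
  have /andP[/order_path_min min_s _] := cupC.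
  have /allP := min_s (fun _ _ _ => @lt_trans _ _ _ _ _).
  by apply; rewrite mem_cat mem_head orbT.
have [sd2 d23] : s.1 < d2.1 /\ d2.1 < d3.1.
  by move: capD; rewrite /chain /= => /andP[/and3P[]].
have sb := lt_trans su ub.
have capD' : chain >%R [:: d2, d3 & d].
  exact: (@chain_catr _ _ [:: s] _ capD).
have osd : orient s d2 d3 < 0.
  by move: capD; rewrite /chain /= => /andP[_ /andP[]]; rewrite slope_gtE.
(* The lengths force [t] to have two points, so [drop (l - 2)] leaves only points of the old cap,
   which are in [S]. *)
have cap_win t : all (mem U) t -> is_cap l (t ++ [:: d2, d3 & d]) ->
    exists c0, [/\ {subset c0 <= U}, is_cap l c0 & {subset drop (l - 2)%N c0 <= S}].
  move=> tU cap; exists (t ++ [:: d2, d3 & d]); split=> //.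
    by apply/allP; rewrite all_cat tU /= d2U d3U.
  have size_t : size t = 2%N.
    move: cap; rewrite is_capE size_cat size_l => /andP[/eqP/= + _].
    by clear; lia.
  rewrite size_l !subSS subn0 drop_cat size_t /= => x /mem_drop.
  by apply/allP: x; rewrite /= d2S d3S.
have cup_win t : all (mem U) t -> is_cup m (e ++ [:: e0, s & t]) ->
    exists c0, [/\ {subset c0 <= U}, is_cup m c0 & {subset take 2 c0 <= S}].
  move=> tU cup; exists (e ++ [:: e0, s & t]); split=> //.
    by apply/allP; rewrite all_cat eU /= e0U sU.
  apply/allP; case: (e) eS => [|x [|y e1]] /=; first by rewrite take0 e0S sS.
    by rewrite e0S => /andP[-> _].
  by rewrite take0 /= => /and3P[-> -> _].
have gon_win A : A `<=` U -> is_convex_gon n A ->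
  exists A', A' `<=` U /\ is_convex_gon n A' by exists A.
have osub : 0 < orient s u b by apply: cup_endpoints cupC.
case: (orientP gen e0U sU d2U e0s sd2) => [oed|oed]; last first.
  constructor 1; apply: (cap_win [:: e0; s]); first by rewrite /= e0U sU.
  rewrite is_capE /=; apply/andP; split; first by rewrite size_l.
  by apply: chain_cons; rewrite /= ?slope_gtE.
have [d2b|bd2|d2b] := ltgtP d2.1 b.1.
- case: (orientP gen sU d2U bU sd2 d2b) => [osb|osb].
    constructor 2; apply: (cup_win [:: d2; b]); first by rewrite /= d2U bU.
    rewrite is_cupE size_cat; apply/andP; split.
      by rewrite size_m /= addn4.
    have := @chain_rcons _ _ (e ++ [:: e0]) s d2 b d2b; rewrite -!catA /=.
    apply; first by rewrite slope_ltE.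
    by apply: chain_rcons; rewrite ?slope_ltE.
  (* Here [d2] lies above the chord [sb] of the (n-1)-cup. *)
  constructor 3; apply: (gon_win [fset x in (s :: c ++ [:: u; b]) ++ [:: d2]]).
    by apply: fset_of_seq_sub; rewrite /= !all_cat /= sU cU uU bU d2U.
  rewrite size_n; apply: (@cup_point_gon _ s).
    by rewrite is_cupE cupC /= size_cat addn2 eqxx.
  by move=> r; rewrite mem_seq1 nth_last /= last_cat => /eqP->.
- case: (orientP gen uU bU d2U ub bd2) => [oubd|oubd].
    constructor 3; apply: (gon_win [fset x in s :: c ++ [:: u; b; d2]]).
      by apply: fset_of_seq_sub; rewrite /= !all_cat /= sU cU uU bU d2U.
    apply: (@cup_gon _ s); rewrite size_n is_cupE.
    rewrite /= size_cat addn3 eqxx.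
    by apply: (@chain_rcons _ _ (s :: c)); rewrite ?slope_ltE.
  case: (orientP gen bU d2U d3U bd2 d23) => [obdd|obdd]; last first.
    constructor 1; apply: (cap_win [:: u; b]); first by rewrite /= uU bU.
    rewrite is_capE /=; apply/andP; split; first by rewrite size_l.
    by apply: chain_cons; rewrite /= ?slope_gtE //; apply: chain_cons; rewrite /= ?slope_gtE.
  case: (orientP gen e0U sU uU e0s su) => [oesu|oesu].
    constructor 2; apply: (cup_win [:: u; b]); first by rewrite /= uU bU.
    rewrite is_cupE size_cat; apply/andP; split.
      by rewrite size_m /= addn4.
    have := @chain_rcons _ _ (e ++ [:: e0]) s u b ub; rewrite -!catA /=.
    apply; first by rewrite slope_ltE.
    by apply: chain_rcons; rewrite ?slope_ltE.
  have ud2 := lt_trans ub bd2.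
  (* Since [u] is below and [d2] above the line [e0 s], the triple [s], [u], [d2] is a cup; with the
     cap [s], [d2], [d3] this makes [u], [d2], [d3] a cap. *)
  have osud := cup_bcd e0s su ud2 oesu oed.
  have oudd := cap_bcd su ud2 d23 osud osd.
  (* [v] is the predecessor of [u] in the cup, namely [s] itself when [c] is empty. *)
  have [c' [v vE]] : exists c', exists v, s :: c = c' ++ [:: v].
    by exists (belast s c), (last s c); rewrite cats1 -lastI.
  have cupC' : chain <%R (c' ++ [:: v; u; b]).
    by move: cupC; rewrite -cat_cons vE -catA.
  have cupu : chain <%R (c' ++ [:: v; u]).
    by apply: (@chain_catl _ _ _ [:: b]); rewrite -catA.
  have vu : v.1 < u.1 by have /chain_catr := cupu; rewrite chain2.
  have vU : v \in U.
    suff : all (mem U) (s :: c) by rewrite vE all_cat /= andbT => /andP[].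
    by rewrite /= sU.
  case: (orientP gen vU uU d2U vu ud2) => [ovud|ovud]; last first.
    constructor 1; apply: (cap_win [:: v; u]); first by rewrite /= vU uU.
    rewrite is_capE /=; apply/andP; split; first by rewrite size_l.
    by apply: chain_cons; rewrite /= ?slope_gtE //; apply: chain_cons; rewrite /= ?slope_gtE.
  constructor 3.
  apply: (gon_win [fset x in (s :: c ++ [:: u; d2]) ++ [:: b]]).
    by apply: fset_of_seq_sub; rewrite /= !all_cat /= sU cU uU bU d2U.
  rewrite size_n; apply: (@cup_point_gon _ s).
    rewrite is_cupE /= size_cat addn2 eqxx /=.
    rewrite -cat_cons vE -catA.
    by apply: chain_rcons; rewrite ?slope_ltE.
  move=> r; rewrite mem_seq1 nth_last /= last_cat => /eqP->; split=> //=.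
  exact: cap_abc osd obdd.
(* Equal x-coordinates would give [d2 = b], a common point of the disjoint sets [S] and [B]. *)
have [gen1 _] := gen.
by have := disj _ d2S; rewrite (gen1 _ _ d2U bU d2b) bB.
Qed.
End Goodness.

(** * The Erdős-Szekeres cups-caps bound *)

Section CupsCaps.
Variable R : realType.
Implicit Types (p q s : R * R) (c t : seq (R * R)) (S A : {fset R * R}).

Lemma general_position_sub A S : A `<=` S ->
  general_position S -> general_position A.
Proof.
move=> /fsubsetP AS [gen1 gen2]; split.
  by move=> p q /AS pS /AS; apply: gen1.
by move=> p q s /AS pS /AS qS /AS; apply: gen2.
Qed.

Lemma cup_cap_free_sub m l A S : A `<=` S ->
  cup_cap_free m l S -> cup_cap_free m l A.
Proof.
move=> /fsubsetP AS [cupS capS].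
by split=> c cA; [apply: cupS | apply: capS] => x /cA /AS.
Qed.

Lemma card_le1 S : general_position S ->
  (forall p q, p \in S -> q \in S -> p.1 < q.1 -> False) -> (#|` S| <= 1)%N.
Proof.
move=> [inj_x _] no2; rewrite leqNgt; apply/negP => S_gt1.
have /fset0Pn[p pS] : S != fset0 by rewrite -cardfs_gt0 ltnW.
have /fset0Pn[q] : S `\ p != fset0.
  by rewrite -cardfs_gt0 -(ltn_add2l 1) addn0; rewrite (cardfsD1 p) pS in S_gt1.
rewrite in_fsetD1 => /andP[qp qS].
have [pq|qp'|/(inj_x _ _ pS qS) pq] := ltgtP p.1 q.1.
- exact: no2 pq.
- exact: no2 qp'.
- by rewrite pq eqxx in qp.
Qed.

Lemma card_sep S (P : pred (R * R)) :
  #|` S| = (#|` [fset s in S | P s]| + #|` [fset s in S | ~~ P s]|)%N.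
Proof.
set A := [fset s in S | P s]; rewrite -(cardfsID A S).
have -> : S `&` A = A by apply/fsetIidPr/fset_sub.
have -> // : S `\` A = [fset s in S | ~~ P s].
by apply/fsetP => x; rewrite !inE /=; case: (x \in S); rewrite ?andbT ?andbF.
Qed.

(** Shifting both parameters by 2 avoids truncated subtraction. Base cases: any two points form a
    2-cup and a 2-cap. Otherwise [S] is split by whether a point is the right endpoint of a cup one
    shorter than the forbidden one, matching Pascal's rule. *)
Lemma card_cup_cap_free m l S : general_position S ->
  cup_cap_free m.+2 l.+2 S -> (#|` S| <= 'C(m + l, m))%N.
Proof.
elim: m l S => [|m IHm] l S gen free.
  rewrite bin0; apply: card_le1 => // p q pS qS pq.
  have /free.1 : {subset [:: p; q] <= S} by apply/allP; rewrite /= pS qS.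
  by rewrite is_cupE chain2 pq.
elim: l S gen free => [|l IHl] S gen free.
  rewrite addn0 binn; apply: card_le1 => // p q pS qS pq.
  have /free.2 : {subset [:: p; q] <= S} by apply/allP; rewrite /= pS qS.
  by rewrite is_capE chain2 pq.
pose P s := `[< exists c, {subset rcons c s <= S} /\ is_cup m.+2 (rcons c s) >].
rewrite (card_sep S P) addSn addnS binS.
apply: leq_add; last first.
  rewrite -addnS; apply: IHm; first exact: general_position_sub (fset_sub _ _) gen.
  split=> c cS; last by apply: free.2 => x /cS; rewrite !inE => /andP[].
  apply/negP => cupc; case/lastP: c => [|c s] in cS cupc *; first by [].
  have := cS s; rewrite !inE mem_rcons mem_head => /(_ isT) /andP[_ /negP[]]; apply/asboolP.
  by exists c; split=> // x /cS; rewrite !inE => /andP[].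
rewrite -addSn; apply: IHl; first exact: general_position_sub (fset_sub _ _) gen.
split=> c cS; first by apply: free.1 => x /cS; rewrite !inE => /andP[].
apply/negP; rewrite is_capE => /andP[/eqP size_c capc].
have cS' x : x \in c -> x \in S by move=> /cS; rewrite !inE => /andP[].
case: c => [|t [|t2 c]] // in cS cS' size_c capc *.
have := cS t (mem_head _ _); rewrite !inE => /andP[tS /asboolP[x []]].
case/lastP: x => [|x a] //; rewrite -!cats1 -catA is_cupE /=.
move=> xS /andP[/eqP size_x cupx].
have aS : a \in S by apply: xS; rewrite mem_cat mem_head orbT.
have t2S : t2 \in S by apply: cS'; rewrite !inE eqxx orbT.
have at_ : a.1 < t.1 by have /chain_catr := cupx; rewrite chain2.
have tt2 : t.1 < t2.1 by have /(@chain_catl _ _ [:: t; t2]) := capc; rewrite chain2.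
(* The cup ends in [a], [t] and the cap begins with [t], [t2]: a left turn at [t] extends the cup by
   [t2], a right turn extends the cap by [a]. *)
case: (orientP gen aS tS t2S at_ tt2) => o.
  have cS1 : {subset x ++ [:: a; t; t2] <= S}.
    move=> y; rewrite mem_cat !inE => /or4P[yx|/eqP->|/eqP->|/eqP->] //.
    by apply: xS; rewrite mem_cat yx.
  move: (free.1 _ cS1); apply/negP/negPn; rewrite is_cupE; apply/andP; split.
    by move: size_x; rewrite !size_cat /= => /eqP; rewrite !addnS.
  by apply: chain_rcons; rewrite ?slope_ltE.
have aS2 : {subset [:: a, t, t2 & c] <= S}.
  by move=> y; rewrite in_cons => /orP[/eqP->|/cS'].
move: (free.2 _ aS2); apply/negP/negPn; rewrite is_capE -size_c eqxx /=.
by apply: chain_cons; rewrite /= ?slope_gtE.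
Qed.

End CupsCaps.

(** * Counting, and existence of the good point *)

Lemma leq_g m l : (4 <= m)%N -> (5 <= l)%N ->
  ('C(m - 4 + (l - 2), m - 4) + 'C(m - 2 + (l - 3), m - 2) <= g m l)%N.
Proof.
move=> hm hl.
have [[a mE] [b lE]] : (exists a, m = a.+4) /\ (exists b, l = b.+3.+2).
  by split; [exists (m - 4)%N | exists (l - 5)%N]; lia.
rewrite /g (_ : m - 4 + (l - 2) = (a + b).+3)%N; last by lia.
rewrite (_ : m - 2 + (l - 3) = (a + b).+4)%N; last by lia.
rewrite (_ : m + l - 4 = (a + b).+4.+1)%N; last by lia.
rewrite (_ : m + l - 6 = (a + b).+3)%N; last by lia.
have -> : 'C((a + b).+3, l - 3) = 'C((a + b).+3, a.+1).
  by rewrite -bin_sub; [congr 'C(_, _) | ]; lia.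
rewrite (_ : m - 4 = a)%N; last by lia.
rewrite (_ : m - 2 = a.+2)%N; last by lia.
(* Pascal's rule, applied twice, turns the left side into the difference of the first two binomials
   of [g]. *)
by rewrite [in X in (_ <= X)%N]binS (binS (a + b).+3 a); lia.
Qed.

Theorem theorem8 (R : realType) (m l : nat) (hm : (4 <= m)%N) (hl : (5 <= l)%N)
    (S : {fset R * R}) (genS : general_position S) (freeS : cup_cap_free m l S)
    (cardS : (g m l < #|` S|)%N) :
  exists s : R * R,
    [/\ s \in S, good m l S s
      & exists c : seq (R * R),
          {subset s :: c <= S} /\ is_cap (l - 1)%N (s :: c)].
Proof.
pose P s := `[< exists c, {subset s :: c <= S} /\ is_cap (l - 1)%N (s :: c) >].
pose A := [fset s in S | P s].
have AS : A `<=` S by apply: fset_sub.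
have cardSA : (#|` [fset s in S | ~~ P s]| <= 'C(m - 2 + (l - 3), m - 2))%N.
  apply: card_cup_cap_free; first exact: general_position_sub (fset_sub _ _) genS.
  have -> : (m - 2).+2 = m by move: hm; clear; lia.
  have -> : (l - 3).+2 = (l - 1)%N by move: hl; clear; lia.
  split=> c cS; first by apply: freeS.1 => x /cS; rewrite !inE => /andP[].
  (* The left endpoint of an (l-1)-cap outside [A] would belong to [A]. *)
  apply/negP => capc; case: c => [|s c] in cS capc *.
    by move: capc; rewrite is_capE; move: hl; clear => /=; lia.
  have := cS s (mem_head _ _); rewrite !inE => /andP[_ /negP[]]; apply/asboolP.
  by exists c; split=> // x /cS; rewrite !inE => /andP[].
have [[e [eA cupe]]|no_cup] := pselect (exists c, {subset c <= A} /\ is_cup (m - 2) c).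
  have eS x : x \in e -> x \in S by move=> /eA /(fsubsetP AS).
  (* The right endpoint [s] of the (m-2)-cup in [A] is the point sought: being in [A], it also
     starts an (l-1)-cap. *)
  case/lastP: e => [|e s] in eA eS cupe *.
    by move: cupe; rewrite is_cupE; move: hm; clear => /=; lia.
  case/lastP: e => [|e e0] in eA eS cupe *.
    by move: cupe; rewrite is_cupE; move: hm; clear => /=; lia.
  have := eA s; rewrite mem_rcons mem_head => /(_ isT).
  rewrite !inE => /andP[sS /asboolP[c [cS capc]]].
  exists s; split=> //; last by exists c.
  case: c => [|d2 [|d3 d]] in cS capc *.
  - by move: capc; rewrite is_capE; move: hl; clear => /=; lia.
  - by move: capc; rewrite is_capE; move: hl; clear => /=; lia.
  rewrite -!cats1 -catA in eS cupe.
  exact: good_endpoint eS cupe cS capc.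
have cardA : (#|` A| <= 'C(m - 4 + (l - 2), m - 4))%N.
  apply: card_cup_cap_free; first exact: general_position_sub AS genS.
  have -> : (m - 4).+2 = (m - 2)%N by move: hm; clear; lia.
  have -> : (l - 2).+2 = l by move: hl; clear; lia.
  split=> c cA; first by apply/negP => cupc; apply: no_cup; exists c.
  exact: (cup_cap_free_sub AS freeS).2.
move: cardS; rewrite (card_sep S P) -/A ltnNge => /negP[].
exact: leq_trans (leq_add cardA cardSA) (leq_g hm hl).
Qed.
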